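(* Let $R$ be an associative ring with identity and let $C$ be a $\Sigma$-self-orthogonal left $R$-module. The following assertions hold: 1. $\mathrm{l.Add}(C)\text{-}\mathrm{gl.dim}(\mathrm{Gen}[C])=0$ if and only if, for every module $N\in\mathrm{Add}(C)$, every $C$-pure submodule of $N$ is a direct summand of $N$. 2. $\mathrm{l.Add}(C)\text{-}\mathrm{gl.dim}(\mathrm{Gen}[C])\leq 1$ if and only if $\mathrm{Add}(C)$ is closed under $C$-pure submodules.
   Context: Modules are unitary left $R$-modules. $C$ is $\Sigma$-self-orthogonal if $\mathrm{Ext}_R^{i}(C,C^{(I)})=0$ for every $i\geq 1$ and every set $I$. $\mathrm{Add}(C)=\mathrm{Add}_R(C)$ is the class of all $R$-modules isomorphic to direct summands of direct sums of copies of $C$. A module $N$ is $C$-generated if there is an exact sequence $0\to K\to C^{(\Lambda)}\to N\to 0$ for some set $\Lambda$; $\mathrm{Gen}[C]$ is the full subcategory of $R$-modules whose objects are the $C$-generated modules. A submodule $N$ of a module $M$ is $C$-pure if the sequence $0\to N\to M\to M/N\to 0$ remains exact after applying $\mathrm{Hom}_R(C,-)$. For a full subcategory $\mathcal{Z}$ of $R$-modules containing $\mathrm{Add}(C)$, $\mathrm{l.Add}(C)\text{-}\mathrm{gl.dim}(\mathcal{Z})$ is the supremum, over all $M\in\mathcal{Z}$, of the exact left $\mathrm{Add}(C)$-dimension of $M$, i.e. the least integer $m\geq 0$ for which there is an exact sequence of $R$-modules $0\to A_m\to\cdots\to A_0\to M\to 0$ with all $A_i\in\mathrm{Add}(C)$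 ($\infty$ if there is none). *)

(* Defs.v *)
From HB Require Import structures.
From mathcomp Require Import all_boot all_order all_algebra.
From mathcomp Require Import finmap boolp classical_sets functions cardinality fsbigop.

Set Implicit Arguments.
Unset Strict Implicit.
Unset Printing Implicit Defensive.

Import GRing.Theory.
Local Open Scope classical_set_scope.
Local Open Scope ring_scope.
Local Open Scope quotient_scope.

(* [R : pzRingType] is an arbitrary associative unital ring, the zero ring
   included; [lmodType R] is the type of unitary left [R]-modules.  Every
   module carries a choice structure, which costs nothing classically. *)

Section Modules.
Context {R : pzRingType}.

(* Submodules of [M] are library [submodClosed M] predicates. *)
Section Submodule.
Context {M : lmodType R} (S : submodClosed M).

Definition submod : Type := {x : M | x \in S}.
HB.instance Definition _ := SubChoice.on submod.
HB.instance Definition _ := [SubChoice_isSubLmodule of submod by <:].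

Definition submod_incl (x : submod) : M := \val x.
HB.instance Definition _ := GRing.Linear.copy submod_incl (\val : submod -> M).

(* [submodClosed] does not record closure under opposites, which the
   library's quotient of Z-modules asks for. *)
Definition submod_pred : {pred M} := S.
HB.instance Definition _ :=
  GRing.isZmodClosed.Build M submod_pred (GRing.submod_closedB (submodClosedP S)).

Definition quotmod : Type := Quotient.quot submod_pred.
HB.instance Definition _ := ZmodQuotient.on quotmod.

Definition quotmod_proj (x : M) : quotmod := \pi_quotmod x.
HB.instance Definition _ :=
  GRing.isZmodMorphism.Build M quotmod quotmod_proj
    (@pi_is_zmod_morphism _ _ _ quotmod).

Fact quotmod_projP x y : quotmod_proj x = quotmod_proj y <-> x - y \in S.
Proof.
rewrite -[_ \in S]/(x - y \in submod_pred) Quotient.idealrBE.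
by split=> [e|/eqP//]; apply/eqP.
Qed.

Fact quotmod_reprK x : quotmod_proj (repr x) = x.
Proof. exact: reprK. Qed.

Definition quotmod_scale (a : R) (x : quotmod) : quotmod :=
  quotmod_proj (a *: repr x).

Fact quotmod_scaleE a x : quotmod_scale a (quotmod_proj x) = quotmod_proj (a *: x).
Proof.
by apply/quotmod_projP; rewrite -scalerBr rpredZ//; apply/quotmod_projP/quotmod_reprK.
Qed.

Fact quotmod_scaleA a b x :
  quotmod_scale a (quotmod_scale b x) = quotmod_scale (a * b) x.
Proof. by rewrite -[x]quotmod_reprK !quotmod_scaleE scalerA. Qed.

Fact quotmod_scale1 : left_id 1 quotmod_scale.
Proof. by move=> x; rewrite -[x]quotmod_reprK quotmod_scaleE scale1r. Qed.

Fact quotmod_scaleDr : right_distributive quotmod_scale +%R.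
Proof.
move=> a x y; rewrite -[x]quotmod_reprK -[y]quotmod_reprK.
by rewrite -raddfD !quotmod_scaleE scalerDr raddfD.
Qed.

Fact quotmod_scaleDl x : {morph quotmod_scale^~ x : a b / a + b}.
Proof.
by move=> a b; rewrite -[x]quotmod_reprK !quotmod_scaleE scalerDl raddfD.
Qed.

HB.instance Definition _ := GRing.Zmodule_isLmodule.Build R quotmod
  quotmod_scaleA quotmod_scale1 quotmod_scaleDr quotmod_scaleDl.

Fact quotmod_proj_scalable : scalable quotmod_proj.
Proof. by move=> a x; rewrite -[RHS]/(quotmod_scale _ _) quotmod_scaleE. Qed.

HB.instance Definition _ :=
  GRing.isScalable.Build R M quotmod *:%R quotmod_proj quotmod_proj_scalable.

End Submodule.

Definition direct_summand (M : lmodType R) (S : submodClosed M) : Prop :=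
  exists T : submodClosed M,
    (forall x, x \in S -> x \in T -> x = 0) /\
    (forall x, exists s t, [/\ s \in S, t \in T & x = s + t]).

Definition isomorphic (M N : lmodType R) : Prop :=
  exists f : {linear M -> N}, bijective f.

(* The direct sum of copies of [C] indexed by [I] consists of the finitely
   supported functions from [I] to [C]. *)
Section DirectSum.
Context (I : Type) (C : lmodType R).

Definition fin_supp : {pred I -> C} :=
  fun f => `[< finite_set [set i | f i != 0] >].

Fact fin_supp_submod : submod_closed fin_supp.
Proof.
split=> [|a f g /asboolP fF /asboolP gF]; apply/asboolP.
  by apply: sub_finite_set (finite_set0 I) => i /=; rewrite eqxx.
apply: sub_finite_set (_ : _ `<=` [set i | f i != 0] `|` [set i | g i != 0]) _.
  move=> i /=; have [fi0|] := eqVneq (f i) 0; last by left.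
  have [gi0|] := eqVneq (g i) 0; last by right.
  by rewrite -[_ i]/(a *: f i + g i) fi0 gi0 scaler0 addr0 eqxx.
by rewrite finite_setU.
Qed.

HB.instance Definition _ :=
  GRing.isSubmodClosed.Build R (I -> C) fin_supp fin_supp_submod.

Definition dsum : lmodType R := submod fin_supp.

End DirectSum.

Definition exact_at (A B D : zmodType) (f : A -> B) (g : B -> D) : Prop :=
  forall b, g b = 0 <-> exists a, f a = b.

Definition surj (A B : Type) (f : A -> B) : Prop := forall b, exists a, f a = b.

Definition short_exact (K M N : lmodType R)
    (f : {linear K -> M}) (g : {linear M -> N}) : Prop :=
  [/\ injective f, exact_at f g & surj g].

(* Exactness of 0 -> Hom(C,K) -> Hom(C,M) -> Hom(C,N) -> 0. *)
Definition hom_short_exact (C K M N : lmodType R)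
    (f : {linear K -> M}) (g : {linear M -> N}) : Prop :=
  [/\ forall u v : {linear C -> K}, f \o u =1 f \o v -> u =1 v,
      forall u : {linear C -> M},
        (forall x, g (u x) = 0) <-> exists v : {linear C -> K}, f \o v =1 u
    & forall w : {linear C -> N}, exists u : {linear C -> M}, g \o u =1 w].

(* Exact sequences ... -> A_1 -> A_0 -> M -> 0. *)
Record left_resolution (M : lmodType R) := LeftResolution {
  res_mod :> nat -> lmodType R;
  res_diff : forall n, {linear res_mod n.+1 -> res_mod n};
  res_aug : {linear res_mod 0 -> M};
  res_aug_surj : surj res_aug;
  res_exact0 : exact_at (res_diff 0) res_aug;
  res_exactS : forall n, exact_at (res_diff n.+1) (res_diff n)
}.

(* The cohomology of the complex Hom(P_0,N) -> Hom(P_1,N) -> ... *)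
Section Cohomology.
Context {M : lmodType R} (P : left_resolution M) (n : nat) (N : lmodType R).

Definition cocycle : {pred P n -> N} :=
  fun f => `[< linear f /\ forall x, f (res_diff P n x) = 0 >].

Fact cocycle_zmod : zmod_closed cocycle.
Proof.
split=> [|f g /asboolP[fL f0] /asboolP[gL g0]]; apply/asboolP.
  by split=> // a x y; rewrite scaler0 addr0.
split=> [a x y|x]; rewrite -![(f - g) _]/(f _ - g _) ?f0 ?g0 ?subrr//.
by rewrite fL gL scalerBr opprD addrACA.
Qed.

HB.instance Definition _ :=
  GRing.isZmodClosed.Build (P n -> N) cocycle cocycle_zmod.

Definition cocycles : Type := {f : P n -> N | f \in cocycle}.
HB.instance Definition _ := SubChoice.on cocycles.
HB.instance Definition _ := [SubChoice_isSubZmodule of cocycles by <:].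

Definition coboundary : {pred cocycles} := fun f => `[<
  match n return (P n -> N) -> Prop with
  | 0 => fun f => f = 0
  | k.+1 => fun f => exists g : {linear P k -> N}, f = g \o res_diff P k
  end (\val f) >].

Fact coboundary_zmod : zmod_closed coboundary.
Proof.
have boundB : forall (Q : (P n -> N) -> Prop), Q 0 ->
    (forall f g, Q f -> Q g -> Q (f - g)) ->
    zmod_closed (fun u : cocycles => `[< Q (\val u) >]).
  by move=> Q Q0 QB; split=> [|u v /asboolP uQ /asboolP vQ]; apply/asboolP;
    rewrite ?raddfB//; exact: QB.
apply: boundB; first by case: n => [//|k]; exists (\0).
case: n => [f g -> ->|k _ _ [f ->] [g ->]]; first exact: subrr.
by exists (f \- g).
Qed.

HB.instance Definition _ :=
  GRing.isZmodClosed.Build cocycles coboundary coboundary_zmod.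

Definition cohomology : zmodType := Quotient.quot coboundary.

End Cohomology.

(* The free resolution of [M] in which each syzygy is covered by the free
   module on all of its elements. *)
Section FreeResolution.

Definition free_module (X : Type) : lmodType R := dsum X R^o.

Section Cover.
Context (M : lmodType R).

Definition free_cover (f : free_module M) : M :=
  \sum_(x \in [set: M]) (\val f x : R) *: (x : M).

Fact free_cover_linear : linear free_cover.
Proof.
move=> a f g; have supp0 h x : h \in @fin_supp M R^o ->
    x \notin fset_set [set y | h y != 0] -> h x = 0.
  by move=> /asboolP hF; rewrite in_fset_set// => /negP; rewrite inE => /negP/negPn/eqP.
set A := fset_set [set y | \val f y != 0]; set B := fset_set [set y | \val g y != 0].
have out x : x \notin (A `|` B)%fset -> \val f x = 0 /\ \val g x = 0.
  by rewrite inE negb_or => /andP[xA xB]; split; apply: supp0 => //; exact: valP.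
have coverE (h : free_module M) : (forall x, x \notin (A `|` B)%fset -> \val h x = 0) ->
    free_cover h = \sum_(x <- (A `|` B)%fset) (\val h x : R) *: (x : M).
  by move=> h0; apply: fsbigTE => x /h0 ->; exact: scale0r.
rewrite !coverE; try by move=> x /out[].
  rewrite scaler_sumr -big_split /=; apply: eq_bigr => x _.
  by rewrite scalerA -scalerDl.
move=> x /out[f0 g0]; rewrite -[LHS]/(a * \val f x + \val g x) f0 g0.
by rewrite mulr0 addr0.
Qed.

HB.instance Definition _ := GRing.isLinear.Build R (free_module M) M *:%R
  free_cover free_cover_linear.

Fact free_cover_surj : surj free_cover.
Proof.
move=> m; pose e x : R^o := if x == m then 1 else 0.
have e0 x : x != m -> e x = 0 by rewrite /e => /negPf->.
have eF : e \in @fin_supp M R^o.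
  apply/asboolP; apply: sub_finite_set (finite_set1 m) => x /=.
  by have [//|/e0->] := eqVneq x m; rewrite eqxx.
exists (Sub e eF); rewrite /free_cover /= (fsbigTE [fset m]%fset).
  by rewrite big_seq_fset1 /e eqxx scale1r.
by move=> x; rewrite inE => /e0->; rewrite scale0r.
Qed.

Definition free_ker : {pred free_module M} := fun f => free_cover f == 0.

Fact free_ker_submod : submod_closed free_ker.
Proof.
split=> [|a f g /eqP f0 /eqP g0]; apply/eqP; first exact: raddf0.
by rewrite free_cover_linear f0 g0 scaler0 addr0.
Qed.

HB.instance Definition _ :=
  GRing.isSubmodClosed.Build R (free_module M) free_ker free_ker_submod.

End Cover.

Context (M : lmodType R).

Fixpoint syzygy (n : nat) : lmodType R :=
  if n is k.+1 then submod (@free_ker (syzygy k)) else M.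

Definition free_res_diff n : free_module (syzygy n.+1) -> free_module (syzygy n) :=
  @submod_incl _ (@free_ker (syzygy n)) \o @free_cover (syzygy n.+1).
HB.instance Definition _ n := GRing.Linear.on (@free_res_diff n).

Fact free_res_exact0 : exact_at (@free_res_diff 0) (@free_cover M).
Proof.
move=> b; split=> [b0|[a <-]]; last exact/eqP/(valP (free_cover a)).
have bK : b \in @free_ker M by apply/eqP.
have [a ab] := @free_cover_surj (syzygy 1) (Sub b bK).
by exists a; rewrite /free_res_diff /= ab /submod_incl SubK.
Qed.

Fact free_res_exactS n : exact_at (@free_res_diff n.+1) (@free_res_diff n).
Proof.
move=> b; split=> [b0|[a <-]].
  have bK : b \in @free_ker (syzygy n.+1) by apply/eqP/val_inj.
  have [a ab] := @free_cover_surj (syzygy n.+2) (Sub b bK).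
  by exists a; rewrite /free_res_diff /= ab /submod_incl SubK.
rewrite /free_res_diff /=; have /eqP -> := valP (free_cover a).
exact: raddf0.
Qed.

Definition free_resolution : left_resolution M :=
  LeftResolution (res_diff := fun n => @free_res_diff n)
    (@free_cover_surj M) free_res_exact0 free_res_exactS.

End FreeResolution.

Definition Ext (n : nat) (M N : lmodType R) : zmodType :=
  cohomology (free_resolution M) n N.

Definition Sigma_self_orthogonal (C : lmodType R) : Prop :=
  forall n, (1 <= n)%N -> forall (I : Type) (x : Ext n C (dsum I C)), x = 0.

Definition in_Add (C M : lmodType R) : Prop :=
  exists (I : Type) (S : submodClosed (dsum I C)),
    direct_summand S /\ isomorphic M (submod S).

Definition in_Gen (C N : lmodType R) : Prop :=
  exists (I : Type) (K : lmodType R)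
    (f : {linear K -> dsum I C}) (g : {linear dsum I C -> N}), short_exact f g.

Definition C_pure (C M : lmodType R) (S : submodClosed M) : Prop :=
  hom_short_exact C (@submod_incl M S) (@quotmod_proj M S).

End Modules.

(* Natural numbers extended with infinity. *)
Variant enat := Fin of nat | Infty.

Definition le_enat (x y : enat) : bool :=
  match x, y with
  | _, Infty => true
  | Fin m, Fin n => (m <= n)%N
  | Infty, Fin _ => false
  end.

Definition least (P : nat -> Prop) : enat :=
  if pselect (exists n, `[< P n >]) is left exP then Fin (ex_minn exP) else Infty.

Section Dimension.
Context {R : pzRingType} (C : lmodType R).

(* 0 -> A_m -> ... -> A_0 -> M -> 0, extended to the left by zero modules *)
Definition Add_resolution_le (m : nat) (M : lmodType R) : Prop :=
  exists A : left_resolution M,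
    (forall n, (n <= m)%N -> in_Add C (A n)) /\
    (forall n, (m < n)%N -> forall x : A n, x = 0).

Definition left_Add_dim (M : lmodType R) : enat :=
  least (fun m => Add_resolution_le m M).

(* The supremum in [enat], that is, the least upper bound. *)
Definition left_Add_gldim (Z : lmodType R -> Prop) : enat :=
  least (fun m => forall M, Z M -> le_enat (left_Add_dim M) (Fin m)).

End Dimension.

(* Main.v *)
(** Every C-generated module M has a canonical cover C^(Hom(C,M)) -> M through
    which all maps C -> M factor, so its kernel is C-pure; this gives both
    converse implications.  Conversely a C-pure submodule S of N in Add(C) has
    quotient Q = N/S in Gen[C].  If Q lies in Add(C), its identity lifts to N and
    S splits off.  If 0 -> A1 -> A0 -> Q -> 0 is exact with A1, A0 in Add(C), then
    Ext^1(C,A1) = 0 makes it Hom(C,-)-exact, and Schanuel's lemma relative to C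
    exhibits S as a direct summand of the direct sum of A1 and N. *)
From HB Require Import structures.
From mathcomp Require Import all_boot all_algebra.
From mathcomp Require Import finmap boolp classical_sets functions cardinality fsbigop.
Require Import Defs.

Set Implicit Arguments.
Unset Strict Implicit.
Unset Printing Implicit Defensive.

Import GRing.Theory.
Local Open Scope classical_set_scope.
Local Open Scope ring_scope.

(** * Factorisation of linear maps, kernels, quotients and summands *)

Section LinearMaps.
Context {R : pzRingType}.
Implicit Types K L M N X : lmodType R.

Lemma linear_map_of M N (f : M -> N) :
  linear f -> exists F : {linear M -> N}, F =1 f.
Proof.
move=> fL; pose mix := GRing.isLinear.Build R M N *:%R f fL.
by exists (HB.pack_for {linear M -> N} f mix).
Qed.

(** Preimages under an injective map are unique, so pointwise chosen ones depend linearly on the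
    argument. *)
Lemma factor_inj K M X (f : {linear K -> M}) (u : {linear X -> M}) :
    injective f -> (forall x, exists a, f a = u x) ->
  exists v : {linear X -> K}, forall x, f (v x) = u x.
Proof.
move=> finj /choice[v fv].
have vL : linear v by move=> a x y; apply: finj; rewrite linearP !fv linearP.
by have [V VE] := linear_map_of vL; exists V => x; rewrite VE.
Qed.

(** A set-theoretic section of [g] fails to be linear only by elements of the kernel of [g], and [u]
    kills these. *)
Lemma factor_surj M N L (g : {linear M -> N}) (u : {linear M -> L}) :
    surj g -> (forall x, g x = 0 -> u x = 0) ->
  exists v : {linear N -> L}, forall x, v (g x) = u x.
Proof.
move=> /choice[s gs] gu.
have us x : u (s (g x)) = u x.
  by apply/eqP; rewrite -subr_eq0 -linearB gu// linearB gs subrr.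
have vL : linear (u \o s).
  move=> a y z /=; rewrite -linearP -[RHS]us.
  by congr (u (s _)); rewrite linearP !gs.
by have [V VE] := linear_map_of vL; exists V => x; rewrite VE /= us.
Qed.

Definition lin_ker_pred M N (g : {linear M -> N}) : {pred M} := fun x => g x == 0.

Lemma lin_ker_submod M N (g : {linear M -> N}) : submod_closed (lin_ker_pred g).
Proof.
split=> [|a x y /eqP gx /eqP gy]; apply/eqP; first exact: raddf0.
by rewrite linearP gx gy scaler0 addr0.
Qed.

HB.instance Definition _ M N (g : {linear M -> N}) :=
  GRing.isSubmodClosed.Build R M (lin_ker_pred g) (lin_ker_submod g).

Definition lin_ker M N (g : {linear M -> N}) : submodClosed M := lin_ker_pred g.

Lemma lin_kerE M N (g : {linear M -> N}) x : (x \in lin_ker g) = (g x == 0).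
Proof. by []. Qed.

Lemma submod_incl_inj M (S : submodClosed M) : injective (@submod_incl R M S).
Proof. exact: val_inj. Qed.

Lemma submod_inclP M (S : submodClosed M) x :
  x \in S <-> exists s, @submod_incl R M S s = x.
Proof.
split=> [xS|[s <-]]; last exact: (valP s).
by exists (Sub x xS); rewrite /submod_incl SubK.
Qed.

Lemma submod_predB M (S : submodClosed M) x y : x \in S -> y \in S -> x - y \in S.
Proof. by case: (GRing.submod_closedB (submodClosedP S)) => _; apply. Qed.

Lemma quotmod_proj_surj M (S : submodClosed M) : surj (@quotmod_proj R M S).
Proof. by move=> y; exists (repr y); exact: quotmod_reprK. Qed.

Lemma quotmod_proj_eq0 M (S : submodClosed M) x :
  @quotmod_proj R M S x = 0 <-> x \in S.
Proof. by rewrite -(raddf0 (@quotmod_proj R M S)) quotmod_projP subr0. Qed.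

Lemma short_exact_submod M (S : submodClosed M) :
  short_exact (@submod_incl R M S) (@quotmod_proj R M S).
Proof.
split; [exact: submod_incl_inj | | exact: quotmod_proj_surj].
by move=> x; rewrite quotmod_proj_eq0 submod_inclP.
Qed.

Lemma short_exact_lin_ker M N (g : {linear M -> N}) :
  surj g -> short_exact (@submod_incl R M (lin_ker g)) g.
Proof.
move=> gS; split=> // x.
by rewrite -submod_inclP lin_kerE; split=> /eqP.
Qed.

(** A complement makes the [S]-component of an element unique, hence linear; conversely the kernel
    of a retraction is a complement. *)
Lemma direct_summandP M (S : submodClosed M) :
  direct_summand S <->
  exists p : {linear M -> submod S}, forall s, p (submod_incl s) = s.
Proof.
split=> [[T [ST0 dec]]|[p pK]].
  have /choice[s sP] x : exists s : M, s \in S /\ x - s \in T.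
    by have [s [t [sS tT ->]]] := dec x; exists s; rewrite addrC addKr.
  have s_uniq x y : y \in S -> x - y \in T -> s x = y.
    have [sS xsT] := sP x => yS xyT; apply/eqP; rewrite -subr_eq0; apply/eqP.
    apply: ST0; first exact: submod_predB.
    (* [s x - y] is the difference of [x - y] and [x - s x], both in [T]. *)
    by rewrite -(subrKA x) addrC -[X in _ + X]opprB; exact: submod_predB.
  have sL : linear s.
    move=> a x y; have [sx tx] := sP x; have [sy ty] := sP y.
    apply: s_uniq; first by rewrite rpredD ?rpredZ.
    by rewrite opprD addrACA -scalerBr rpredD ?rpredZ.
  have [s' s'E] := linear_map_of sL.
  have [x|p pE] := @factor_inj _ _ _ (@submod_incl R M S) s' (@submod_incl_inj _ S).
    by apply/submod_inclP; rewrite s'E; have [] := sP x.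
  exists p => x; apply: submod_incl_inj; rewrite pE s'E; apply: s_uniq.
    exact: (valP x).
  by rewrite subrr rpred0.
exists (lin_ker p); split=> [x /submod_inclP[s <-]|x].
  by rewrite lin_kerE pK => /eqP ->; exact: raddf0.
exists (submod_incl (p x)), (x - submod_incl (p x)).
split; [exact: (valP (p x)) | | by rewrite addrC subrK].
by rewrite lin_kerE linearB pK subrr.
Qed.

End LinearMaps.

(** * Direct sums and lifting of maps *)

Section DirectSums.
Context {R : pzRingType}.
Implicit Types (I J X : Type) (A C D M N : lmodType R).

Section Injection.
Context (I : Type) (C : lmodType R) (i : I).

(** Indices are compared classically, as [I] is an arbitrary type. *)
Definition dsum_single (c : C) : I -> C := fun j => if `[< i = j >] then c else 0.

Lemma dsum_single_fin_supp c : dsum_single c \in @fin_supp R I C.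
Proof.
apply/asboolP; apply: sub_finite_set (finite_set1 i) => j /=.
by rewrite /dsum_single; case: asboolP => [->//|_]; rewrite eqxx.
Qed.

Definition dsum_inj (c : C) : dsum I C := Sub (dsum_single c) (dsum_single_fin_supp c).

Lemma val_dsum_inj c j : \val (dsum_inj c) j = if `[< i = j >] then c else 0.
Proof. by []. Qed.

Lemma dsum_inj_linear : linear dsum_inj.
Proof.
move=> a c d; apply: val_inj; apply: funext => j.
rewrite -[RHS]/(a *: \val (dsum_inj c) j + \val (dsum_inj d) j) !val_dsum_inj.
by case: ifP => // _; rewrite scaler0 addr0.
Qed.

HB.instance Definition _ :=
  GRing.isLinear.Build R C (dsum I C) *:%R dsum_inj dsum_inj_linear.

End Injection.

Lemma dsum_ext I C N (F G : {linear dsum I C -> N}) :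
  (forall i c, F (dsum_inj i c) = G (dsum_inj i c)) -> F =1 G.
Proof.
move=> FG f; have /asboolP/(@finite_seqP {classic I})[s sE] := valP f.
(* Only containment of the support in [s] is kept, so that the induction can peel off one coordinate
   at a time. *)
have {sE} : forall i, i \notin (s : seq {classic I}) -> \val f i = 0.
  move=> i /negP; apply: contra_notP => /eqP fi0.
  by have : [set j | \val f j != 0] i by []; rewrite sE.
elim: s f => [|i s IH] f f0.
  have -> : f = 0 by apply: val_inj; apply: funext => i; exact: f0.
  by rewrite !linear0.
rewrite -[f](subrK (dsum_inj i (\val f i))) [LHS]linearD [RHS]linearD FG.
congr (_ + _); apply: IH => j js.
rewrite -[LHS]/(\val f j - \val (dsum_inj i (\val f i)) j) val_dsum_inj.
case: asboolP => [->|ij]; first exact: subrr.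
by rewrite subr0 f0// inE negb_or js andbT; apply/eqP => ji; exact: ij.
Qed.

Lemma dsum_copair_choice (I : choiceType) C N (phi : I -> {linear C -> N}) :
  exists F : {linear dsum I C -> N}, forall i c, F (dsum_inj i c) = phi i c.
Proof.
pose F (f : dsum I C) := \sum_(i \in [set: I]) phi i (\val f i).
pose supp (f : dsum I C) := fset_set [set i | \val f i != 0].
have supp0 f i : i \notin supp f -> \val f i = 0.
  have /asboolP fF := valP f.
  by rewrite in_fset_set// => /negP; rewrite inE => /negP/negPn/eqP.
(* Summing over any finite set containing the support lets [f], [g] and [a *: f + g] share one index
   set. *)
have FE (A : {fset I}) f : (forall i, i \notin A -> \val f i = 0) ->
    F f = \sum_(i <- A) phi i (\val f i).
  by move=> f0; apply: fsbigTE => i /f0 ->; exact: raddf0.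
have FL : linear F.
  move=> a f g; have out i : i \notin (supp f `|` supp g)%fset ->
      \val f i = 0 /\ \val g i = 0.
    by rewrite inE negb_or => /andP[/supp0 ? /supp0].
  rewrite !(FE (supp f `|` supp g)%fset); try by move=> i /out[].
    by rewrite scaler_sumr -big_split; apply: eq_bigr => i _; exact: linearP.
  move=> i /out[f0 g0]; rewrite -[LHS]/(a *: \val f i + \val g i) f0 g0.
  by rewrite scaler0 addr0.
have [F' F'E] := linear_map_of FL; exists F' => i c; rewrite F'E.
rewrite (FE [fset i]%fset) => [|j].
  by rewrite big_seq_fset1 val_dsum_inj; case: asboolP.
by rewrite inE val_dsum_inj => ji; case: asboolP => // ij; rewrite ij eqxx in ji.
Qed.

Lemma dsum_copair I C N (phi : I -> {linear C -> N}) :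
  exists F : {linear dsum I C -> N}, forall i c, F (dsum_inj i c) = phi i c.
Proof. exact: (@dsum_copair_choice {classic I}). Qed.

(** Surjectivity of [Hom(C, g)]. *)
Definition lifts C M N (g : {linear M -> N}) : Prop :=
  forall w : {linear C -> N}, exists u : {linear C -> M}, g \o u =1 w.

Lemma lifts_dsum I C M N (g : {linear M -> N}) : lifts C g -> lifts (dsum I C) g.
Proof.
move=> gC w; have /choice[u uE] i := gC (w \o dsum_inj i : {linear _ -> _}).
have [U UE] := dsum_copair u; exists U.
by apply: (@dsum_ext I C N (g \o U)) => i c /=; rewrite UE; exact: uE.
Qed.

Lemma lifts_retract A D M N (g : {linear M -> N})
    (a : {linear A -> D}) (b : {linear D -> A}) :
  cancel a b -> lifts D g -> lifts A g.
Proof.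
move=> ab gD w; have [u uE] := gD (w \o b : {linear _ -> _}).
by exists (u \o a : {linear _ -> _}) => x /=; rewrite [LHS]uE /= ab.
Qed.

(** A free module is a direct sum of copies of [R^o], and a map out of [R^o] is fixed by its value
    at 1. *)
Lemma lifts_free X M N (g : {linear M -> N}) : surj g -> lifts (free_module X) g.
Proof.
move=> gS; apply: lifts_dsum => w; have [m gm] := gS (w 1).
have uL : linear (fun r : R^o => r *: m) by move=> a r s; rewrite scalerDl scalerA.
have [u uE] := linear_map_of uL; exists u => r /=.
by rewrite uE linearZ /= gm -linearZ; congr (w _); exact: mulr1.
Qed.

End DirectSums.

(** * Vanishing of Ext as extension of maps *)

Lemma cohomology_eq0 (R : pzRingType) (M N : lmodType R) (P : left_resolution M) n :
    (forall x : cohomology P n.+1 N, x = 0) ->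
  forall z : {linear P n.+1 -> N}, (forall y, z (res_diff P n.+1 y) = 0) ->
  exists h : {linear P n -> N}, forall y, z y = h (res_diff P n y).
Proof.
move=> H0 z zd; have zC : (z : P n.+1 -> N) \in @cocycle R M P n.+1 N.
  by apply/asboolP; split=> // a x y; exact: linearP.
pose x : cocycles P n.+1 N := exist _ (z : _ -> _) zC.
have := H0 (\pi_(cohomology P n.+1 N)%qT x).
rewrite -(raddf0 (\pi_(cohomology P n.+1 N)%qT)) => /eqP.
rewrite -Quotient.idealrBE subr0 => /asboolP[h hE]; exists h => y.
exact: (congr1 (fun F => F y) hE).
Qed.

Lemma free_cover_incl (R : pzRingType) (M : lmodType R) (y : submod (@free_ker R M)) :
  free_cover (submod_incl y) = 0.
Proof. exact/eqP/(valP y). Qed.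

(** Composed with the free cover of the first syzygy, [v] becomes a 1-cocycle; a cochain bounding it
    extends [v], because that cover is onto. *)
Lemma Ext1_extend (R : pzRingType) (M N : lmodType R) :
    (forall x : Ext 1 M N, x = 0) ->
  forall v : {linear syzygy M 1 -> N},
  exists h : {linear free_module M -> N}, forall y, v y = h (submod_incl y).
Proof.
move=> H0 v.
have vd y : (v \o @free_cover R (syzygy M 1)) (res_diff (free_resolution M) 1 y) = 0.
  rewrite -[LHS]/(v (free_cover (submod_incl (free_cover y)))).
  by rewrite free_cover_incl linear0.
have [h hE] := cohomology_eq0 (P := free_resolution M) H0 vd.
by exists h => y; have [y' <-] := @free_cover_surj _ (syzygy M 1) y; exact: hE.
Qed.

(** * Closure properties of Add(C) *)

Section AddGen.
Context {R : pzRingType} (C : lmodType R).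
Implicit Types (I : Type) (A B M N S Q : lmodType R).

(** Splitting maps replace submodules, so that closure properties of Add(C) become compositions of
    linear maps. *)
Lemma in_Add_retractP A :
  in_Add C A <-> exists I (a : {linear A -> dsum I C}) (b : {linear dsum I C -> A}),
    cancel a b.
Proof.
split=> [[I [S [/direct_summandP[p pK] [f [h fh hf]]]]]|[I [a [b ab]]]].
  have hL : linear h.
    by move=> r x y; apply: (can_inj fh); rewrite linearP !hf.
  have [h' h'E] := linear_map_of hL.
  exists I, (@submod_incl _ _ S \o f : {linear _ -> _}), (h' \o p : {linear _ -> _}).
  by move=> x /=; rewrite h'E pK fh.
(* The image of the idempotent [a \o b] is realised as the kernel of [e]. *)
pose e : {linear dsum I C -> dsum I C} := idfun \- (a \o b).
have eE x : (x \in lin_ker e) = (a (b x) == x).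
  by rewrite lin_kerE /= subr_eq0 eq_sym.
have [x|p pE] := @factor_inj _ _ _ _ _ (a \o b : {linear _ -> _})
    (@submod_incl_inj _ _ (lin_ker e)).
  by apply/submod_inclP; rewrite eE /= ab.
have [x|f fE] := @factor_inj _ _ _ _ _ a (@submod_incl_inj _ _ (lin_ker e)).
  by apply/submod_inclP; rewrite eE ab.
have inclE s : a (b (submod_incl s)) = @submod_incl _ _ (lin_ker e) s.
  by apply/eqP; rewrite -eE; exact: (valP s).
exists I, (lin_ker e); split.
  apply/direct_summandP; exists p => s; apply: submod_incl_inj.
  by rewrite pE /= inclE.
exists f, (b \o @submod_incl _ _ (lin_ker e)) => x /=.
  by rewrite fE ab.
by apply: submod_incl_inj; rewrite fE inclE.
Qed.

Lemma in_Add_dsum I : in_Add C (dsum I C).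
Proof. by apply/in_Add_retractP; exists I, idfun, idfun. Qed.

(* The last hypothesis makes [S] a retract of the direct sum of [A] and [B]. *)
Lemma in_Add_retract2 A B S
    (a : {linear S -> A}) (b : {linear S -> B})
    (c : {linear A -> S}) (d : {linear B -> S}) :
    in_Add C A -> in_Add C B -> (forall x, c (a x) + d (b x) = x) -> in_Add C S.
Proof.
move=> /in_Add_retractP[I [a1 [a2 aK]]] /in_Add_retractP[J [b1 [b2 bK]]] cd.
(* [ia] and [ib] embed the two blocks of the sum over [I + J]; [p] returns them to [S] through [c]
   and [d]. *)
apply/in_Add_retractP; exists (I + J)%type.
have [ia iaE] := dsum_copair (fun i => @dsum_inj _ (I + J)%type C (inl i) : {linear _ -> _}).
have [ib ibE] := dsum_copair (fun j => @dsum_inj _ (I + J)%type C (inr j) : {linear _ -> _}).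
have [p pE] := dsum_copair (fun s : (I + J)%type => match s with
  | inl i => c \o a2 \o dsum_inj i : {linear C -> S}
  | inr j => d \o b2 \o dsum_inj j : {linear C -> S} end).
have pia : p \o ia =1 c \o a2 by apply: dsum_ext => i x /=; rewrite iaE pE.
have pib : p \o ib =1 d \o b2 by apply: dsum_ext => i x /=; rewrite ibE pE.
exists ((ia \o a1 \o a) \+ (ib \o b1 \o b) : {linear _ -> _}), p => x /=.
rewrite linearD -[p (ia _)]/((p \o ia) _) pia -[p (ib _)]/((p \o ib) _) pib /=.
by rewrite aK bK.
Qed.

Lemma in_Add_retract A S (a : {linear S -> A}) (c : {linear A -> S}) :
  cancel a c -> in_Add C A -> in_Add C S.
Proof.
move=> ac CA; apply: (@in_Add_retract2 A A S a a c \0) => // x.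
by rewrite ac addr0.
Qed.

(** The zero module is a retract of the empty direct sum. *)
Lemma in_Add_subsingleton S : (forall x : S, x = 0) -> in_Add C S.
Proof.
move=> S0; apply: (@in_Add_retract (dsum void C) S \0 \0 _ (in_Add_dsum _)) => x.
by rewrite [RHS]S0.
Qed.

(** Lifting passes from [C] to direct sums and then to retracts, so members of Add(C) act as
    projectives relative to [C]. *)
Lemma lifts_Add A M N (g : {linear M -> N}) : in_Add C A -> lifts C g -> lifts A g.
Proof.
by move=> /in_Add_retractP[I [a [b ab]]] gC; apply: lifts_retract ab (lifts_dsum gC).
Qed.

(** * C-generated modules and C-purity *)

Lemma in_GenP N : in_Gen C N <-> exists I (g : {linear dsum I C -> N}), surj g.
Proof.
split=> [[I [K [f [g [_ _ gS]]]]]|[I [g gS]]]; first by exists I, g.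
by exists I, (submod (lin_ker g)), (@submod_incl _ _ (lin_ker g)), g;
  exact: short_exact_lin_ker.
Qed.

Lemma in_Gen_Add_quot A N (g : {linear A -> N}) : in_Add C A -> surj g -> in_Gen C N.
Proof.
move=> /in_Add_retractP[I [a [b ab]]] gS; apply/in_GenP.
exists I, (g \o b : {linear _ -> _}) => y; have [x <-] := gS y.
by exists (a x); rewrite /= ab.
Qed.

Lemma Gen_cover N : in_Gen C N ->
  exists2 g : {linear dsum {linear C -> N} C -> N}, surj g & lifts C g.
Proof.
move=> /in_GenP[I [h hS]].
have [g gE] := dsum_copair (fun u : {linear C -> N} => u).
have gC : lifts C g.
  by move=> w; exists (dsum_inj w : {linear _ -> _}) => x; exact: gE.
(* The given surjection [h] factors through [g], so [g] is onto as well. *)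
exists g => // y; have [x <-] := hS y; have [u uE] := lifts_dsum gC h.
by exists (u x); exact: uE.
Qed.

(** By left exactness of Hom the first two conditions hold for every submodule; only lifting along
    the projection remains. *)
Lemma C_pureP M (S : submodClosed M) : C_pure C S <-> lifts C (@quotmod_proj _ M S).
Proof.
split=> [[]//|pS]; split=> // [u v uv x|u].
  by apply: submod_incl_inj; exact: uv.
split=> [u0|[v vu] x]; last first.
  by rewrite -vu; apply/quotmod_proj_eq0/submod_inclP; eexists.
have [x|v vE] := @factor_inj _ _ _ _ _ u (@submod_incl_inj _ _ S).
  by apply/submod_inclP/quotmod_proj_eq0; exact: u0.
by exists v.
Qed.

Lemma C_pure_lin_ker M N (g : {linear M -> N}) :
  surj g -> lifts C g -> C_pure C (lin_ker g).
Proof.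
move=> gS gC; apply/C_pureP => w.
(* [v] is induced by [g] on the quotient. A lift of [v \o w] along [g] also lifts [w], since
   elements with equal image under [g] agree in the quotient. *)
have [x|v vE] := factor_surj (u := g) (@quotmod_proj_surj _ _ (lin_ker g)).
  by move=> /quotmod_proj_eq0; rewrite lin_kerE => /eqP.
have [u uE] := gC (v \o w : {linear _ -> _}); exists u => x /=.
rewrite -[w x]quotmod_reprK; apply/quotmod_projP; rewrite lin_kerE linearB.
by rewrite -[g (u x)]/((g \o u) x) uE /= -[X in v X]quotmod_reprK vE subrr.
Qed.

(** * Relative Schanuel lemma and lifting from orthogonality *)

Lemma Schanuel_Add S N A1 A0 Q
    (k : {linear S -> N}) (p : {linear N -> Q})
    (f : {linear A1 -> A0}) (g : {linear A0 -> Q}) :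
    short_exact k p -> short_exact f g -> lifts C p -> lifts C g ->
    in_Add C N -> in_Add C A1 -> in_Add C A0 -> in_Add C S.
Proof.
move=> [kI kp _] [fI fg _] pC gC CN CA1 CA0.
(* No pullback is formed: [al] and [be] compare the sequences over [Q]. On kernels they restrict to
   [e] and [d], and [c] is [idfun \- (be \o al)] with values in [S]; so [d (e x) + c (k x) = x]. *)
have [al alE] := lifts_Add CN gC p.
have [be beE] := lifts_Add CA0 pC g.
have gal x : g (al x) = p x := alE x.
have pbe x : p (be x) = g x := beE x.
have [x|d dE] := @factor_inj _ _ _ _ _ (be \o f : {linear _ -> _}) kI.
  by apply/kp; rewrite /= pbe; apply/fg; exists x.
have [x|e eE] := @factor_inj _ _ _ _ _ (al \o k : {linear _ -> _}) fI.
  by apply/fg; rewrite /= gal; apply/kp; exists x.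
have [x|c cE] := @factor_inj _ _ _ _ _ (idfun \- (be \o al) : {linear _ -> _}) kI.
  by apply/kp; rewrite /= linearB /= pbe gal subrr.
apply: (@in_Add_retract2 A1 N S e k d c) => // x.
by apply: kI; rewrite linearD dE cE /= eE /= addrC subrK.
Qed.

(* The chase computing the connecting map [Hom(C, M) -> Ext^1(C, A1)]. *)
Lemma orthogonal_lifts A1 A0 M (f : {linear A1 -> A0}) (g : {linear A0 -> M}) :
    Sigma_self_orthogonal C -> in_Add C A1 -> short_exact f g -> lifts C g.
Proof.
move=> hC /in_Add_retractP[J [i [p ip]]] [fI fg gS] w.
have [u uE] := lifts_free gS (w \o @free_cover R C : {linear _ -> _}).
have gu x : g (u x) = w (free_cover x) := uE x.
have [x|v vE] := @factor_inj _ _ _ _ _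
    (u \o @submod_incl _ _ (@free_ker R C) : {linear syzygy C 1 -> A0}) fI.
  by apply/fg; rewrite /= gu free_cover_incl linear0.
(* Orthogonality concerns direct sums of copies of [C], so [v] is pushed into one by [i]; [p] later
   brings the extension back. *)
have [h hE] := Ext1_extend (hC 1 isT J) (i \o v : {linear _ -> _}).
have ivE y : i (v y) = h (submod_incl y) := hE y.
(* The corrected [u] vanishes on the syzygy and descends to [C]; the correction lies in the image of
   [f], so [g] does not see it. *)
have [x|t tE] := factor_surj (u := u \- (f \o p \o h) : {linear _ -> _})
    (@free_cover_surj R C).
  move=> /eqP xK; have [y <-] : exists y, @submod_incl _ _ (@free_ker R C) y = x.
    exact/submod_inclP.
  by rewrite /= -ivE ip vE subrr.
exists t => c /=; have [x <-] := @free_cover_surj R C c.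
by rewrite tE /= linearB gu (iffRL (fg _)) ?subr0//; eexists.
Qed.

(** * Resolutions of length at most one and dimension bounds *)

Lemma short_exact_resolution A1 A0 M (f : {linear A1 -> A0}) (g : {linear A0 -> M}) :
    short_exact f g ->
  exists A : left_resolution M,
    [/\ A 0 = A0, A 1 = A1 & forall n (x : A n.+2), x = 0].
Proof.
move=> [fI fg gS]; pose Z := @dsum R void M.
have Z0 (x : Z) : x = 0 by apply: val_inj; apply: funext; case.
pose T n : lmodType R := match n with 0 => A0 | 1 => A1 | _ => Z end.
pose d n : {linear T n.+1 -> T n} :=
  match n return {linear T n.+1 -> T n} with 0 => f | _ => \0 end.
have dS n : exact_at (d n.+1) (d n).
  case: n => [|n] b; split=> [b0|[a <-]].
  - by exists 0; apply: fI; rewrite b0 !linear0.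
  - exact: linear0.
  - by exists 0; rewrite linear0 [RHS]Z0.
  - exact: linear0.
by exists (@LeftResolution _ _ T d g gS fg dS).
Qed.

Lemma Add_resolution_le0P M : Add_resolution_le C 0 M <-> in_Add C M.
Proof.
split=> [[A [CA A0]]|CM].
  (* As [A 1] is zero, the augmentation is injective and the identity of [A 0] descends to its
     inverse [v]. *)
  have [x /(@res_exact0 _ _ A x)[y <-]|v vE] := factor_surj (u := idfun) (@res_aug_surj _ _ A).
    by rewrite (A0 1 isT y) linear0.
  apply: (@in_Add_retract (A 0) M v (res_aug A)) (CA 0 isT) => y.
  by have [x <-] := @res_aug_surj _ _ A y; rewrite vE.
have Z0 (x : dsum void M) : x = 0 by apply: val_inj; apply: funext; case.
have se : short_exact (\0 : {linear dsum void M -> M}) (idfun : {linear M -> M}).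
  split=> [x y _|b|b]; [by rewrite (Z0 x) (Z0 y) | | by exists b].
  by split=> [b0|[a <-]]; [exists 0; exact: esym b0 | exact: linear0].
have [A [A0 A1 AS]] := short_exact_resolution se; exists A; split.
  by case=> // _; rewrite A0.
by case=> // [[_|n _]]; [rewrite A1 | exact: AS].
Qed.

Lemma Add_resolution_le1P M : Add_resolution_le C 1 M <->
  exists A1 A0 (f : {linear A1 -> A0}) (g : {linear A0 -> M}),
    [/\ in_Add C A1, in_Add C A0 & short_exact f g].
Proof.
split=> [[A [CA A0]]|[A1 [A0 [f [g [CA1 CA0 se]]]]]].
  exists (A 1), (A 0), (res_diff A 0), (res_aug A); split; try exact: CA.
  split; [|exact: res_exact0|exact: res_aug_surj].
  apply: raddf_inj => x /(@res_exactS _ _ A 0 x)[y <-].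
  by rewrite (A0 2 isT y) linear0.
have [A [A0E A1E AS]] := short_exact_resolution se; exists A; split.
  by case=> [|[|//]] _; rewrite ?A0E ?A1E.
by case=> [//|[//|n _]]; exact: AS.
Qed.

Lemma Add_resolution_le_trans m n M :
  (m <= n)%N -> Add_resolution_le C m M -> Add_resolution_le C n M.
Proof.
move=> mn [A [CA A0]]; exists A; split=> k kn; last exact/A0/(leq_ltn_trans mn).
(* Terms beyond [m] are zero, and zero lies in Add(C). *)
by have [/CA//|/A0/in_Add_subsingleton] := leqP k m.
Qed.

Lemma le_leastP (P : nat -> Prop) m :
    (forall i j, (i <= j)%N -> P i -> P j) -> le_enat (least P) (Fin m) <-> P m.
Proof.
move=> Pmono; rewrite /least; case: pselect => [exP|nP] /=; last first.
  by split=> // Pm; case: nP; exists m; apply/asboolP.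
case: ex_minnP => k /asboolP Pk kmin; split=> [km|Pm]; first exact: Pmono Pk.
by apply: kmin; apply/asboolP.
Qed.

(** Dimension and supremum are both least bounds of monotone predicates, so [le_leastP] applies
    twice. *)
Lemma le_left_Add_gldimP (Z : lmodType R -> Prop) m :
  le_enat (left_Add_gldim C Z) (Fin m) <->
  forall M, Z M -> Add_resolution_le C m M.
Proof.
have dimP k M : le_enat (left_Add_dim C M) (Fin k) <-> Add_resolution_le C k M.
  by apply: le_leastP => i j; exact: Add_resolution_le_trans.
rewrite le_leastP => [|i j ij H M /H/dimP Mi]; last first.
  by apply/dimP; exact: Add_resolution_le_trans Mi.
by split=> H M /H/dimP.
Qed.

Lemma le_enat0 x : le_enat x (Fin 0) <-> x = Fin 0.
Proof. by case: x => [[]|]. Qed.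

(** * The two characterisations *)

Lemma Gen_gldim_eq0P : left_Add_gldim C (in_Gen C) = Fin 0 <->
  forall N, in_Add C N -> forall S : submodClosed N, C_pure C S -> direct_summand S.
Proof.
rewrite -le_enat0 le_left_Add_gldimP; split=> [H N CN S /C_pureP pS|H M GM].
  have qS := @quotmod_proj_surj _ _ S.
  have /Add_resolution_le0P CQ := H _ (in_Gen_Add_quot CN qS).
  have [s sE] := lifts_Add CQ pS idfun.
  have qs y : quotmod_proj S (s y) = y := sE y.
  (* Subtracting [s] after the projection from the identity retracts [N] onto [S]. *)
  have [x|p pE] := @factor_inj _ _ _ _ _
      (idfun \- (s \o @quotmod_proj _ _ S) : {linear _ -> _}) (@submod_incl_inj _ _ S).
    apply/submod_inclP/quotmod_proj_eq0; rewrite /= linearB /=.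
    by rewrite qs subrr.
  apply/direct_summandP; exists p => x; apply: submod_incl_inj.
  rewrite pE /= (iffRL (quotmod_proj_eq0 _ _)) ?linear0 ?oppr0 ?addr0//.
  exact: (valP x).
apply/Add_resolution_le0P; have [g gS gC] := Gen_cover GM.
have /direct_summandP[p pK] := H _ (in_Add_dsum _) _ (C_pure_lin_ker gS gC).
(* The complementary projection kills the kernel of [g], so it descends to a section [v] of [g]. *)
have [x|v vE] := factor_surj
    (u := idfun \- (@submod_incl _ _ (lin_ker g) \o p) : {linear _ -> _}) gS.
  by move=> /eqP; rewrite -lin_kerE => /submod_inclP[y <-] /=; rewrite pK subrr.
apply: (in_Add_retract (a := v) (c := g)) (in_Add_dsum _) => y.
have [x <-] := gS y; rewrite vE /= linearB [X in _ - X](_ : _ = 0) ?subr0//.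
by apply/eqP; rewrite -lin_kerE; exact: (valP (p x)).
Qed.

Lemma Gen_gldim_le1P (hC : Sigma_self_orthogonal C) :
  le_enat (left_Add_gldim C (in_Gen C)) (Fin 1) <->
  forall N, in_Add C N -> forall S : submodClosed N, C_pure C S -> in_Add C (submod S).
Proof.
rewrite le_left_Add_gldimP; split=> [H N CN S /C_pureP pS|H M GM].
  have GQ := in_Gen_Add_quot CN (@quotmod_proj_surj _ _ S).
  have /Add_resolution_le1P[A1 [A0 [f [g [CA1 CA0 se]]]]] := H _ GQ.
  have gC := orthogonal_lifts hC CA1 se.
  exact: (Schanuel_Add (short_exact_submod S) se pS gC CN CA1 CA0).
(* The cover and its C-pure kernel already form a resolution of length one. *)
have [g gS gC] := Gen_cover GM; apply/Add_resolution_le1P.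
exists (submod (lin_ker g)), (dsum {linear C -> M} C), (@submod_incl _ _ (lin_ker g)), g.
split; [|exact: in_Add_dsum|exact: short_exact_lin_ker].
exact: H (in_Add_dsum _) _ (C_pure_lin_ker gS gC).
Qed.

End AddGen.

Theorem proposition4p7 (R : pzRingType) (C : lmodType R)
    (hC : Sigma_self_orthogonal C) :
  (left_Add_gldim C (in_Gen C) = Fin 0 <->
   (forall N : lmodType R, in_Add C N ->
      forall S : submodClosed N, C_pure C S -> direct_summand S)) /\
  (le_enat (left_Add_gldim C (in_Gen C)) (Fin 1) <->
   (forall N : lmodType R, in_Add C N ->
      forall S : submodClosed N, C_pure C S -> in_Add C (submod S))).
Proof. by split; [exact: Gen_gldim_eq0P | exact: Gen_gldim_le1P]. Qed.
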